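(* Let $k$ be a non-negative integer and let $g$ be an integer with $2k+1\leq g\leq 3k-4$. Then $\kappa_g(\Gamma_{k,0})>f_{3k}(g)$, where $f_{n}(g)=n(g+1)-\frac{g(g+3)}{2}$.
   Context: All graphs are finite, simple, undirected. For a group $G$ with identity $e$ and a subset $S\subseteq G\setminus\{e\}$ with $S=S^{-1}$, the Cayley graph $\mathrm{Cay}(G,S)$ has vertex set $G$ and edge set $\{\{g,sg\}\mid g\in G,s\in S\}$. For $1\le i\le k$ let $H_i=\langle a_i,b_i\mid a_i^4=b_i^2=1,\ b_i^{-1}a_ib_i=a_i^{-1}\rangle$ be the dihedral group of order $8$. Set $G_{k,0}=H_1\times H_2\times\cdots\times H_k$, $\Omega_{k,0}=\{a_i^2,\,b_i,\,a_ib_i\mid 1\leq i\leq k\}$, and $\Gamma_{k,0}=\mathrm{Cay}(G_{k,0},\Omega_{k,0})$. For a connected graph $G$ and an integer $g\ge 0$, a set $S$ of vertices is a cutset if $G-S$ is not connected; a cutset $S$ is an $R_g$-cutset if every connected component of $G-S$ has at least $g+1$ vertices. If $G$ has at least one $R_g$-cutset, the $g$-extra connectivity $\kappa_g(G)$ is the minimum cardinality of an $R_g$-cutset of $G$. *)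

(* Defs.v *)
From HB Require Import structures.
From mathcomp Require Import all_boot all_order all_algebra all_fingroup all_solvable.

Set Implicit Arguments.
Unset Strict Implicit.
Unset Printing Implicit Defensive.

Import Order.TTheory GRing.Theory Num.Theory GroupScope.

(* Graphs are represented by their adjacency relation on a finite type of
   vertices; simple undirected graphs are the symmetric irreflexive ones. *)

Section Graphs.

Variables (T : finType) (adj : rel T).
Implicit Type S : {set T}.

(* Adjacency in the graph with the vertices in S deleted. *)
Definition del_adj S : rel T :=
  [rel x y | [&& x \notin S, y \notin S & adj x y]].

(* Meaningful for x \notin S. *)
Definition component S (x : T) : {set T} :=
  [set y | connect (del_adj S) x y].

Definition del_connected S : bool :=
  [forall x in ~: S, forall y in ~: S, connect (del_adj S) x y].

(* Deleting every vertex does not give a cutset: the empty graph is connected. *)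
Definition cutset S : bool := ~~ del_connected S.

Definition Rg_cutset (g : nat) S : bool :=
  cutset S && [forall x in ~: S, g.+1 <= #|component S x|].

(* Set to 0 when there is no R_g-cutset, so that a positive lower bound on
   kappa g entails that the g-extra connectivity is defined. *)
Definition kappa (g : nat) : nat :=
  if [pick S | Rg_cutset g S] is Some S0
  then #|[arg min_(S < S0 | Rg_cutset g S) #|S| ]| else 0.

Lemma kappa_min g S : Rg_cutset g S ->
  exists S0, [/\ Rg_cutset g S0, #|S0| = kappa g
    & forall S', Rg_cutset g S' -> kappa g <= #|S'|].
Proof.
rewrite /kappa => cS; case: pickP => [S1 cS1|/(_ S)]; last by rewrite cS.
by case: arg_minnP => // S0 cS0 minS0; exists S0.
Qed.

Lemma kappa_none g : (forall S, ~~ Rg_cutset g S) -> kappa g = 0.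
Proof. by rewrite /kappa => nS; case: pickP => // S /(negP (nS S)). Qed.

End Graphs.

Definition cayley (gT : finGroupType) (S : {set gT}) : rel gT :=
  fun x y => [exists s in S, y == s * x].

Lemma cayley_sym (gT : finGroupType) (S : {set gT}) :
  S^-1 = S -> symmetric (cayley S).
Proof.
move=> SV; suff sub x y : cayley S x y -> cayley S y x.
  by move=> x y; apply/idP/idP; apply: sub.
case/exists_inP=> s Ss /eqP->; apply/exists_inP; exists s^-1.
  by rewrite -SV memV_invg.
by rewrite mulKg.
Qed.

Lemma cayley_irrefl (gT : finGroupType) (S : {set gT}) :
  1 \notin S -> irreflexive (cayley S).
Proof.
move=> S1 x; apply: contraNF S1 => /exists_inP[s Ss].
by rewrite eq_sym -(inj_eq (mulIg x^-1)) mulgK mulgV => /eqP <-.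
Qed.

(* Generators of the dihedral group of order 8 satisfying the relations of its
   presentation.  As they generate a group of order 8, which is the order of
   the group so presented, the choice is irrelevant up to automorphism. *)
Definition D8_gens (ab : 'D_8 * 'D_8) : bool :=
  [&& <<[set ab.1; ab.2]>> == [set: 'D_8], ab.1 ^+ 4 == 1, ab.2 ^+ 2 == 1
    & ab.1 ^ ab.2 == ab.1^-1].

Lemma D8_gens_ex : exists ab, D8_gens ab.
Proof.
have /isoGrp_hom/existsP[[a b] /= /eqP[dG a4 b2 ab]] := @Grp_dihedral 4 isT.
exists (a, b); rewrite /D8_gens /= a4 b2 ab !eqxx !andbT -dG.
by rewrite joing_idl joing_idr.
Qed.

Definition D8_a : 'D_8 := (xchoose D8_gens_ex).1.
Definition D8_b : 'D_8 := (xchoose D8_gens_ex).2.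

Lemma D8_abP : [/\ <<[set D8_a; D8_b]>> = [set: 'D_8], D8_a ^+ 4 = 1,
  D8_b ^+ 2 = 1 & D8_b^-1 * D8_a * D8_b = D8_a^-1].
Proof.
have /and4P[/eqP ? /eqP ? /eqP ? /eqP] := xchooseP D8_gens_ex.
by rewrite conjgE mulgA.
Qed.

Lemma card_D8 : #|[set: 'D_8]| = 8.
Proof. exact: (@card_dihedral 4). Qed.

Lemma order_D8 : #[D8_a] = 4 /\ #[D8_b] = 2.
Proof.
have [gD a4 b2 ab] := D8_abP.
have nab : <[D8_b]> \subset 'N(<[D8_a]>).
  rewrite norms_cycle; suff -> : D8_a ^ D8_b = D8_a^-1 by rewrite groupV cycle_id.
  by rewrite conjgE mulgA.
have dD : <[D8_a]> * <[D8_b]> = [set: 'D_8].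
  by rewrite -norm_joinEr // joing_idl joing_idr.
have := mul_cardG <[D8_a]> <[D8_b]>; rewrite dD card_D8 -!orderE => e.
have oa : #[D8_a] <= 4 by rewrite dvdn_leq // order_dvdn a4.
have ob : #[D8_b] <= 2 by rewrite dvdn_leq // order_dvdn b2.
have i0 := cardG_gt0 (<[D8_a]> :&: <[D8_b]>).
have le8 : 8 <= #[D8_a] * #[D8_b] by rewrite e leq_pmulr.
move: oa ob le8; case: #[D8_a] => [|[|[|[|[|?]]]]] //; by case: #[D8_b] => [|[|[|?]]].
Qed.

Section Gamma.

Variable k : nat.

Definition Gk : finGroupType := {dffun forall i : 'I_k, 'D_8}.

(* The image of an element of the i-th direct factor in the product. *)
Definition inj_factor (i : 'I_k) (x : 'D_8) : Gk :=
  @dfung1 'I_k (fun=> ('D_8)%type) i x.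

Definition gen_a (i : 'I_k) : Gk := inj_factor i D8_a.
Definition gen_b (i : 'I_k) : Gk := inj_factor i D8_b.

Definition Omega : {set Gk} :=
  \bigcup_(i < k) [set gen_a i ^+ 2; gen_b i; gen_a i * gen_b i].

Definition Gamma : rel Gk := cayley Omega.

Lemma inj_factorM i x y :
  inj_factor i (x * y) = inj_factor i x * inj_factor i y.
Proof. exact: (@dfung1_morphM _ (fun=> ('D_8)%type)). Qed.

Lemma inj_factor1 i : inj_factor i 1 = 1.
Proof. exact: (morph1 (@dfung1_morphism _ (fun=> ('D_8)%type) i)). Qed.

Lemma inj_factor_inj i : injective (inj_factor i).
Proof.
by move=> x y /(congr1 (fun z : Gk => z i)); rewrite /inj_factor !dfung1_id.
Qed.

Lemma OmegaE : Omega =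
  \bigcup_(i < k) [set inj_factor i s | s in [set D8_a ^+ 2; D8_b; D8_a * D8_b]].
Proof.
apply: eq_bigr => i _; rewrite !imsetU !imset_set1 /gen_a /gen_b.
by rewrite !expg2 !inj_factorM.
Qed.

Lemma OmegaP x : reflect (exists i, exists2 s,
    s \in [set D8_a ^+ 2; D8_b; D8_a * D8_b] & x = inj_factor i s) (x \in Omega).
Proof.
rewrite OmegaE; apply: (iffP bigcupP) => [[i _ /imsetP[s]]|[i [s ss ->]]].
  by exists i, s.
by exists i; rewrite ?imset_f.
Qed.

Lemma Omega_inv : Omega^-1 = Omega.
Proof.
have [_ a4 b2 ab] := D8_abP.
suff invo x : x \in Omega -> x^-1 = x.
  apply/setP=> x; rewrite inE; apply/idP/idP => Ox; last by rewrite invo.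
  by rewrite -[x]invgK invo.
case/OmegaP=> i [s ss ->]; apply/eqP; rewrite eq_invg_mul -inj_factorM.
suff -> : s * s = 1 by rewrite inj_factor1.
have bV : D8_b^-1 = D8_b by apply/eqP; rewrite eq_invg_mul -expg2 b2.
move: ss; rewrite !inE -expg2 => /orP[/orP[]|] /eqP-> //.
  by rewrite -expgM.
by move: ab; rewrite bV expg2 => ab; rewrite -mulgA (mulgA D8_b) ab mulgV.
Qed.

Lemma Omega1 : 1 \notin Omega.
Proof.
have [gD _ _ _] := D8_abP; have [oa ob] := order_D8.
apply/OmegaP => -[i [s ss]]; rewrite -(inj_factor1 i) => /inj_factor_inj s1.
move: ss; rewrite -s1 !inE => /orP[/orP[]|]; rewrite eq_sym.
- by rewrite -order_dvdn oa.
- by move/eqP=> b1; move: ob; rewrite b1 order1.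
rewrite -eq_invg_mul => /eqP ab; have := card_D8.
suff -> : [set: 'D_8] = <[D8_a]> by rewrite -orderE oa.
apply/eqP; rewrite eqEsubset subsetT andbT -gD gen_subG subUset !sub1set.
by rewrite cycle_id -ab groupV cycle_id.
Qed.

Lemma gen_Omega : <<Omega>> = [set: Gk].
Proof.
have [gD _ _ _] := D8_abP.
have subO i s : s \in [set D8_a ^+ 2; D8_b; D8_a * D8_b] ->
    inj_factor i s \in <<Omega>>.
  by move=> ss; apply/mem_gen/OmegaP; exists i, s.
have sub i s : inj_factor i s \in <<Omega>>.
  pose f := @dfung1_morphism _ (fun=> ('D_8)%type) i.
  suff : f @* <<[set D8_a; D8_b]>> \subset <<Omega>>.
    by move/subsetP; apply; apply: (mem_morphim f); rewrite ?gD inE.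
  rewrite morphim_gen ?subsetT // gen_subG morphimEsub ?subsetT //.
  apply/subsetP => _ /imsetP[x xab ->]; rewrite -[f x]/(inj_factor i x).
  have Ob : inj_factor i D8_b \in <<Omega>> by rewrite subO // !inE eqxx orbT.
  case/set2P: xab => -> //.
  by rewrite -(groupMr _ Ob) -inj_factorM subO // !inE eqxx !orbT.
apply/eqP; rewrite eqEsubset subsetT; apply/subsetP => x _.
suff -> : x = \prod_(i < k) inj_factor i (x i) by apply: group_prod => i _.
apply/ffunP => i; rewrite prodg_ffun (big_only1 i) ?dfung1_id // => j ij _.
by rewrite /inj_factor dfung1_dflt.
Qed.

Lemma Gamma_sym : symmetric Gamma.
Proof. exact/cayley_sym/Omega_inv. Qed.

Lemma Gamma_irrefl : irreflexive Gamma.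
Proof. exact/cayley_irrefl/Omega1. Qed.

Lemma Gamma_connected x y : connect Gamma x y.
Proof.
have : y * x^-1 \in <<Omega>> by rewrite gen_Omega inE.
case/gen_prodgP=> n [c Oc e]; rewrite -[y](mulgKV x) {}e.
elim: n => [|n IH] in c Oc *; first by rewrite big_ord0 mul1g.
rewrite big_ord_recl -mulgA.
apply: connect_trans (IH (fun i => c (lift ord0 i)) (fun i => Oc _)) _.
by apply: connect1; apply/exists_inP; exists (c ord0).
Qed.

End Gamma.

Arguments Omega : clear implicits.
Arguments Gamma : clear implicits.

Definition f_ (n g : nat) : rat :=
  (n%:R * (g%:R + 1) - (g%:R * (g%:R + 3)) / 2)%R.

(* Main.v *)
Require Import Defs.
From mathcomp Require Import all_boot all_order all_algebra all_fingroup all_solvable.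
From mathcomp Require Import zify lra.

(** The Cayley graph of D8 for the three involutions a^2, b and ab is an
8-cycle with its antipodal chords, and Gamma k is the Cartesian product of k
copies of it.  This product is hypercube-like of dimension n = 3k: it arises
from single vertices by joining, again and again, two such networks of one
dimension less along a perfect matching.

Put h_n(m) = n m - (m - 1)(m + 2) / 2, so that f_n(g) = h_n(g + 1).  In a
hypercube-like network of dimension n, any m > 0 vertices have at least h_n(m)
neighbours outside ([hl_bd_ge]).  By induction, two nonempty halves of sizes
m0 and m1 contribute h_(n-1)(m0) + h_(n-1)(m1) = h_n(m0 + m1) +
(m0 - 1)(m1 - 1), and when one half is empty the matching supplies m neighbours
in it.  The function h_n increases up to n - 1; beyond that point the bound is
replaced by the fact that separating two sets of at least n - 2 vertices takes
at least n (n - 1) / 2 = h_n(n - 2) vertices ([hl_separators_large]).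

Given an R_g-cutset, let A be one component of what is left and B the union of
the others; both have at least g + 1 vertices.  As g <= n - 4, the two bounds
show that the cutset has more than f_n(g) vertices, except if A or B has exactly
g + 1 vertices and attains the bound h_n(g + 1).  Call such a set tight.

For k >= 2 a tight set has at most 2k + 1 vertices ([tight_lt]), whence the
hypothesis 2k + 1 <= g.  The error term (m0 - 1)(m1 - 1) shows that, whenever
two halves joined by a matching both meet a tight set, one of them meets it in
a single vertex x, and x is equal or adjacent to the partner of each other
vertex of the set.  Each factor i of Gamma k gives two such decompositions, with matchings
y |-> b_i y and y |-> a_i b_i y.  If none of the 2k decompositions separates the
vertices of A, the matchings yield 2k |A| distinct neighbours of A, which is too
many.  Otherwise the partner v of some x is a centre of A: apart from at most
one vertex, which can only occur when |A| <= 4, all of A is v and neighbours of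
v.  If |A| > 2k + 1, two of these neighbours are b_j v and a_j b_j v for some j.
Now b_j v is the isolated vertex of a decomposition, and the partner of
a_j b_j v is neither equal nor adjacent to it, a contradiction.

Finally, R_g-cutsets exist: deleting the vertices with a fixed coordinate in
{a^2, b, ab} leaves a disconnected graph, in which each vertex lies in a slice
of 8^(k-1) vertices that is connected because it is hypercube-like. *)

Set Implicit Arguments.
Unset Strict Implicit.
Unset Printing Implicit Defensive.

(** * Hypercube-like networks *)

Section HypercubeLike.

Variables (T : finType) (adj : rel T).
Implicit Types (x y z : T) (V A B : {set T}) (p : T -> T).

Definition joined V0 V1 p : Prop :=
  [/\ [disjoint V0 & V1],
      {in V0, forall x, p x \in V1}, {in V1, forall x, p x \in V0},
      {in V0 :|: V1, involutive p}
    & {in V0 & V1, forall x y, adj x y = (y == p x)}].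

(** The vertex sets that induce a hypercube-like network (also called a
bijective connection network) of a given dimension.  Subsets of one ambient
graph are used so that no graph isomorphisms have to be transported. *)
Inductive hl : nat -> {set T} -> Prop :=
| hl_point x : hl 0 [set x]
| hl_join n V0 V1 p :
    hl n V0 -> hl n V1 -> joined V0 V1 p -> hl n.+1 (V0 :|: V1).

Definition bd V A : {set T} := [set y in V :\: A | [exists x in A, adj x y]].

Lemma bdP V A y :
  reflect [/\ y \in V, y \notin A & exists2 x, x \in A & adj x y]
          (y \in bd V A).
Proof.
rewrite !inE; apply: (iffP andP) => [[/andP[nAy Vy] /exists_inP ex]|] //.
by case=> Vy nAy ex; rewrite Vy nAy; split=> //; apply/exists_inP.
Qed.

Hypothesis adj_sym : symmetric adj.

Lemma joined_sym V0 V1 p : joined V0 V1 p -> joined V1 V0 p.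
Proof.
case=> d01 p0 p1 pK e01; split=> //; first by rewrite disjoint_sym.
  by move=> x; rewrite setUC; apply: pK.
move=> x y Vx Vy; rewrite adj_sym e01 //.
by apply/eqP/eqP=> ->; rewrite pK // inE ?Vx ?Vy ?orbT.
Qed.

Lemma card_halves V0 V1 A : [disjoint V0 & V1] -> A \subset V0 :|: V1 ->
  #|A| = #|A :&: V0| + #|A :&: V1|.
Proof.
move=> d01 /setIidPl {1}<-; rewrite setIUr cardsU.
suff ->: A :&: V0 :&: (A :&: V1) = set0 by rewrite cards0 subn0.
by rewrite setIACA (disjoint_setI0 d01) setI0.
Qed.

Lemma hl_card n V : hl n V -> #|V| = 2 ^ n.
Proof.
elim=> {n V} [x|n V0 V1 p _ c0 _ c1 [d01 _ _ _ _]]; first by rewrite cards1.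
by rewrite cardsU (disjoint_setI0 d01) cards0 c0 c1 expnS; lia.
Qed.

Lemma hl_connect n V (e : rel T) : hl n V ->
    {in V &, forall x y, adj x y -> e x y} ->
  {in V &, forall x y, connect e x y}.
Proof.
move=> hV; elim: hV e => {n V} [x|n V0 V1 p _ c0 _ c1 j01] e adjE.
  by move=> y z /set1P-> /set1P->.
have half V V' : joined V V' p ->
    {in V :|: V' &, forall x y, adj x y -> e x y} ->
    {in V' &, forall x y, connect e x y} ->
    {in V & V', forall x y, connect e x y}.
  case=> _ pV _ _ adjV adjE' cV' x y Vx Vy.
  apply: connect_trans (cV' _ _ (pV _ Vx) Vy); apply/connect1/adjE'.
  - by rewrite inE Vx.
  - by rewrite inE pV ?orbT.
  by rewrite adjV ?pV.
have c0' : {in V0 &, forall x y, connect e x y}.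
  by apply: c0 => x y Vx Vy; apply: adjE; rewrite inE ?Vx ?Vy.
have c1' : {in V1 &, forall x y, connect e x y}.
  by apply: c1 => x y Vx Vy; apply: adjE; rewrite inE ?Vx ?Vy orbT.
move=> x y /setUP[] Vx /setUP[] Vy; first exact: c0'.
- exact: half j01 _ _ _ _ Vx Vy.
- by apply: half (joined_sym j01) _ _ _ _ Vx Vy => //; rewrite setUC.
exact: c1'.
Qed.

Lemma bd_half V V0 A : V0 \subset V -> bd V0 (A :&: V0) \subset bd V A :&: V0.
Proof.
move=> /subsetP sV; apply/subsetP=> y /bdP[V0y nAy [x]].
case/setIP=> Ax _ xy; rewrite !inE V0y !andbT in nAy *.
by rewrite nAy sV //=; apply/exists_inP; exists x.
Qed.

(** The partner of a vertex of A is adjacent to it, so it is in A or in the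
boundary of A. *)
Lemma matched_in_bd V0 V1 p A : joined V0 V1 p -> A \subset V0 :|: V1 ->
  p @: (A :&: V0) :\: (A :&: V1) \subset bd (V0 :|: V1) A :&: V1.
Proof.
case=> _ p0 _ _ adjE sA; apply/subsetP=> y.
case/setDP=> /imsetP[x /setIP[Ax V0x] ->] nA1; have V1px := p0 _ V0x.
rewrite !inE V1px orbT !andbT in nA1 *; rewrite nA1 /=.
by apply/exists_inP; exists x; rewrite // adjE.
Qed.

Lemma card_matched V0 V1 p A : joined V0 V1 p -> A \subset V0 :|: V1 ->
  #|A :&: V0| <= #|bd (V0 :|: V1) A :&: V1| + #|A :&: V1|.
Proof.
move=> j01 sA; have := subset_leq_card (matched_in_bd j01 sA).
have [_ _ _ pK _] := j01; rewrite cardsD card_in_imset => [|x y Ax Ay].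
  by have := subset_leq_card (subsetIr (p @: (A :&: V0)) (A :&: V1)); lia.
have V0x z : z \in A :&: V0 -> z \in V0 :|: V1.
  by case/setIP=> _ V0z; rewrite inE V0z.
by move/(congr1 p); rewrite !pK ?V0x.
Qed.

Lemma card_bd_halves V0 V1 A : [disjoint V0 & V1] ->
  #|bd (V0 :|: V1) A| =
    #|bd (V0 :|: V1) A :&: V0| + #|bd (V0 :|: V1) A :&: V1|.
Proof.
by move=> d01; apply: card_halves => //; apply/subsetP=> y /bdP[].
Qed.

(** The inequality #|bd V A| >= h_n(#|A|), doubled and with the negative term
moved to the other side to stay in the natural numbers. *)
Theorem hl_bd_ge n V A : hl n V -> A \subset V -> A != set0 ->
  2 * n * #|A| + 2 <= 2 * #|bd V A| + #|A| * #|A|.+1.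
Proof.
move=> hV; elim: hV A => {n V} [x|n V0 V1 p _ IH0 _ IH1 j01] A sA nA.
  by rewrite -card_gt0 in nA; nia.
have [d01 _ _ _ _] := j01; rewrite (card_bd_halves _ d01) (card_halves d01 sA).
have b0 := subset_leq_card (@bd_half (V0 :|: V1) V0 A (subsetUl _ _)).
have b1 := subset_leq_card (@bd_half (V0 :|: V1) V1 A (subsetUr _ _)).
have m1 := card_matched j01 sA.
have m0 := card_matched (joined_sym j01); rewrite setUC in m0.
have {}m0 := m0 _ sA.
have := IH0 (A :&: V0) (subsetIr _ _); rewrite -card_gt0.
have := IH1 (A :&: V1) (subsetIr _ _); rewrite -card_gt0.
rewrite -card_gt0 (card_halves d01 sA) in nA.
move: b0 b1 m1 m0 nA; set V := V0 :|: V1.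
move: #|bd V A :&: V0| #|bd V A :&: V1| #|bd _ _| #|bd _ _| => s0 s1 t0 t1.
case: #|A :&: V0| => [|a0]; case: #|A :&: V1| => [|a1] //= b0 b1 m1 m0 _; nia.
Qed.


(** Then V minus A and B is a cut between A and B. *)
Definition separated V A B : Prop :=
  [/\ A \subset V, B \subset V, [disjoint A & B]
    & {in A & B, forall x y, ~~ adj x y}].

Lemma separated_sym V A B : separated V A B -> separated V B A.
Proof.
by case=> sA sB dAB nAB; split; rewrite 1?disjoint_sym // => x y Bx Ay;
  rewrite adj_sym nAB.
Qed.

Lemma separated_half V V0 A B :
  separated V A B -> separated V0 (A :&: V0) (B :&: V0).
Proof.
case=> _ _ dAB nAB; split; rewrite ?subsetIr //.
  by apply: disjointWl (disjointWr _ dAB); rewrite subsetIl.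
by move=> x y /setIP[Ax _] /setIP[By _]; apply: nAB.
Qed.

Lemma card_separated V A B : separated V A B ->
  #|V| = #|A| + #|B| + #|V :\: (A :|: B)|.
Proof.
case=> sA sB dAB _; rewrite -(cardsID (A :|: B) V); congr (_ + _).
have /setIidPr-> : A :|: B \subset V by rewrite subUset sA.
by rewrite cardsU (disjoint_setI0 dAB) cards0 subn0.
Qed.

Lemma bd_separated V A B : separated V A B -> bd V A \subset V :\: (A :|: B).
Proof.
case=> _ _ _ nAB; apply/subsetP=> y /bdP[Vy nAy [x Ax xy]].
by rewrite !inE Vy andbT negb_or nAy; apply: contraL xy; apply: nAB.
Qed.

Lemma separated_exterior V A : A \subset V ->
  separated V A (V :\: (A :|: bd V A)).
Proof.
move=> sA; split; rewrite ?subsetDl //.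
  by rewrite disjoints_subset; apply/subsetP=> x Ax; rewrite !inE Ax.
move=> x y Ax; rewrite !in_setD in_setU negb_or => /andP[/andP[nAy nby] Vy].
by apply: contra nby => xy; apply/bdP; split=> //; exists x.
Qed.

Lemma exterior_separator V A :
  V :\: (A :|: (V :\: (A :|: bd V A))) = bd V A.
Proof.
apply/setP=> x; rewrite !inE.
by case: (x \in A); case: (x \in V); rewrite //= ?andbT ?negbK ?andbF.
Qed.

Definition separators_large n V : Prop := forall A B, separated V A B ->
  n <= #|A| + 2 -> n <= #|B| + 2 -> n * n.-1 <= 2 * #|V :\: (A :|: B)|.

(** The exponential number of vertices beats the quadratic bound from dimension
3 on. *)
Lemma expn2_ge n : 2 < n -> n * n.+1 + 4 * n <= 2 * 2 ^ n + 12.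
Proof.
elim: n => // n IHn; rewrite ltnS leq_eqVlt => /predU1P[<- //|n_gt2].
by have := IHn n_gt2; rewrite expnS; nia.
Qed.

(** A large set A that is small in one half has a large boundary.  If A is also
small in the other half, the two isoperimetric bounds add up to enough.
Otherwise the part of A in V1 either leaves a large exterior in V1, and then a
large boundary there, or it leaves hardly anything, and then the matching makes
the whole boundary exponentially large. *)
Lemma large_half n V0 V1 p A : 2 < n -> hl n V0 -> hl n V1 ->
    joined V0 V1 p -> separators_large n V1 ->
    A \subset V0 :|: V1 -> n + 3 <= #|A| ->
    #|A :&: V0| + 3 <= n ->
  n * n.+1 <= 2 * #|bd (V0 :|: V1) A|.
Proof.
move=> n_gt2 h0 h1 j01 Q1 sA geA lt0.
have [d01 _ _ _ _] := j01; rewrite (card_bd_halves _ d01).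
rewrite (card_halves d01 sA) in geA.
have b0 := subset_leq_card (@bd_half (V0 :|: V1) V0 A (subsetUl _ _)).
have b1 := subset_leq_card (@bd_half (V0 :|: V1) V1 A (subsetUr _ _)).
have m0 := card_matched (joined_sym j01); rewrite setUC in m0.
have {}m0 := m0 _ sA.
have := hl_bd_ge h0 (subsetIr A V0); rewrite -card_gt0.
have := hl_bd_ge h1 (subsetIr A V1); rewrite -card_gt0.
have sepA1 := separated_exterior (subsetIr A V1).
have := Q1 _ _ sepA1; have := card_separated sepA1.
rewrite exterior_separator (hl_card h1); have := expn2_ge n_gt2.
move: b0 b1 m0 geA lt0; set V := V0 :|: V1.
move: #|bd V A :&: V0| #|bd V A :&: V1| #|bd _ _| #|bd _ _| => s0 s1 t1 t0.
move: #|_ :\: _| #|A :&: V0| #|A :&: V1| (2 ^ n) => c a0 a1 N b0 b1 m0 geA lt0.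
move=> leN eN Q IH1 IH0.
have [a1_small|a1_big] := ltnP (a1 + 2) n.
  have h0' : 2 * n * a0 + 2 <= 2 * t0 + a0 * a0.+1 by apply: IH0; lia.
  have h1' : 2 * n * a1 + 2 <= 2 * t1 + a1 * a1.+1 by apply: IH1; lia.
  have [u eu] : exists u, n = a0 + 3 + u by exists (n - a0 - 3); lia.
  have [v ev] : exists v, n = a1 + 3 + v by exists (n - a1 - 3); lia.
  clear Q IH0 IH1; nia.
(* When A misses V0, the matching puts the partners of all of A into the
   boundary; otherwise the isoperimetric bound in V0 suffices. *)
have s0_ge : n <= s0 by clear Q IH1; case: a0 => [|a0] in IH0 geA lt0 m0 *; nia.
have [c_small|c_big] := leqP (c + 3) n; first by clear Q IH1 IH0; nia.
have t1_ge : n * n.-1 <= 2 * t1 by apply: Q; lia.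
by clear Q IH0 IH1; nia.
Qed.

(** In dimension n + 1, either A or B has a large boundary, for instance by
[large_half], or both are large in both halves.  In the latter case the
induction hypothesis applies twice, and 2 * (n * n.-1) >= n.+1 * n.  In
dimension 3 one of A and B has at most 4 of the 8 vertices, where the
isoperimetric bound is enough. *)
Theorem hl_separators_large n V : 2 < n -> hl n V -> separators_large n V.
Proof.
move=> n_gt2 hV; elim: hV n_gt2 => {n V} // n V0 V1 p h0 IH0 h1 IH1 j01.
rewrite ltnS leq_eqVlt => /predU1P[n2|n_gt2] A B sepAB geA geB.
  have [sA sB _ _] := sepAB; have hV := hl_join h0 h1 j01.
  have := subset_leq_card (bd_separated sepAB).
  have := subset_leq_card (bd_separated (separated_sym sepAB)).
  rewrite [B :|: A]setUC; have := card_separated sepAB.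
  rewrite (hl_card hV) -n2 (_ : 2 ^ 3 = 8) // in geA geB *.
  have := hl_bd_ge hV sA; have := hl_bd_ge hV sB; rewrite -n2 -!card_gt0.
  move: #|_ :\: _| #|bd _ A| #|bd _ B| #|A| #|B| geA geB => s t u a b geA geB.
  move=> hb ha e hu ht; have {}hb := hb ltac:(lia); have {}ha := ha ltac:(lia).
  have [a_le4|a_gt4] := leqP a 4.
    by case: a => [|[|[|[|[|a]]]]] // in ha a_le4 geA e *; lia.
  have b_le4 : b <= 4 by lia.
  by case: b => [|[|[|[|[|b]]]]] // in hb b_le4 geB e *; lia.
have := @subset_leq_card _ _ _ (bd_separated (separated_sym sepAB)).
have := subset_leq_card (bd_separated sepAB); rewrite [B :|: A]setUC.
have hV := hl_join h0 h1 j01; have [sA sB _ _] := sepAB.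
have large (C : {set T}) : C \subset V0 :|: V1 -> n < #|C| + 2 ->
    n * n.+1 <= 2 * #|bd (V0 :|: V1) C| \/
    n <= #|C :&: V0| + 2 /\ n <= #|C :&: V1| + 2.
  move=> sC geC.
  (* h_(n+1) is symmetric about n + 1/2, so it is at least its value at n - 1
     on the whole interval from n - 1 to n + 2. *)
  have [C_small|C_big] := ltnP #|C| (n + 3).
    left; have := hl_bd_ge hV sC; rewrite -card_gt0 => /(_ ltac:(lia)).
    move: #|bd _ _| #|C| geC C_small => t c geC C_small.
    have [u eu] : exists u, c.+1 = n + u by exists (c.+1 - n); lia.
    have : u <= 3 by lia.
    by case: u eu => [|[|[|[|u]]]] // eu _; nia.
  have [C0_small|C0_big] := ltnP (#|C :&: V0| + 2) n.
    by left; apply: (large_half n_gt2 h0 h1 j01 (IH1 n_gt2)) => //; lia.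
  have [C1_small|C1_big] := ltnP (#|C :&: V1| + 2) n; last by right.
  left; rewrite setUC in sC *.
  by apply: (large_half n_gt2 h1 h0 (joined_sym j01) (IH0 n_gt2)) => //; lia.
case: (large _ sA geA) (large _ sB geB) => [hA _|[A0 A1] [hB|[B0 B1]]].
- by rewrite /=; lia.
- by rewrite /=; lia.
move=> _ _; have [d01 _ _ _ _] := j01.
have := @card_halves V0 V1 ((V0 :|: V1) :\: (A :|: B)) d01 (subsetDl _ _).
have sub (V' : {set T}) : V' \subset V0 :|: V1 ->
    ((V0 :|: V1) :\: (A :|: B)) :&: V' = V' :\: (A :&: V' :|: B :&: V').
  move/subsetP=> sV'; apply/setP=> x; rewrite !inE.
  case: (boolP (x \in V')) => [/sV'|_]; last by rewrite !andbF.
  by rewrite inE => ->; rewrite !andbT.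
rewrite (sub _ (subsetUl _ _)) (sub _ (subsetUr _ _)).
have := IH0 n_gt2 _ _ (separated_half V0 sepAB) A0 B0.
have := IH1 n_gt2 _ _ (separated_half V1 sepAB) A1 B1.
by rewrite /=; nia.
Qed.

(** Equality in [hl_bd_ge]. *)
Definition tight n V A : Prop :=
  2 * #|bd V A| + #|A| * #|A|.+1 <= 2 * n * #|A| + 2.

(** Equality forces (m0 - 1)(m1 - 1) = 0 for the sizes of the parts of A, and it
leaves no room in V1 for boundary vertices beyond the boundary of A :&: V1
within V1.  In particular the partners of A :&: V0 belong to A :&: V1 or to its
boundary. *)
Lemma tight_split n V0 V1 p A : hl n V0 -> hl n V1 -> joined V0 V1 p ->
    A \subset V0 :|: V1 -> tight n.+1 (V0 :|: V1) A ->
    A :&: V0 != set0 -> A :&: V1 != set0 ->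
  (#|A :&: V0| = 1 \/ #|A :&: V1| = 1) /\
  (forall y, y \in A -> y \in V0 ->
     exists2 x, x \in A :&: V1 & p y = x \/ adj x (p y)).
Proof.
move=> h0 h1 j01 sA tA nA0 nA1; have [d01 p0 _ _ adjE] := j01.
have b0 := subset_leq_card (@bd_half (V0 :|: V1) V0 A (subsetUl _ _)).
have sb1 := @bd_half (V0 :|: V1) V1 A (subsetUr _ _).
have b1 := subset_leq_card sb1.
move: tA; rewrite /tight (card_bd_halves _ d01) (card_halves d01 sA) => tA.
have IH0 := hl_bd_ge h0 (subsetIr A V0) nA0.
have IH1 := hl_bd_ge h1 (subsetIr A V1) nA1.
rewrite -!card_gt0 in nA0 nA1; set V := V0 :|: V1 in b0 sb1 b1 tA *.
have [one b1E] : (#|A :&: V0| = 1 \/ #|A :&: V1| = 1) /\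
    #|bd V A :&: V1| <= #|bd V1 (A :&: V1)|.
  move: b0 b1 tA IH0 IH1 nA0 nA1.
  move: #|bd V A :&: V0| #|bd V A :&: V1| #|bd V0 _| #|bd V1 _| => s0 s1 t0 t1.
  case: #|A :&: V0| #|A :&: V1| => [|a0] [|a1] // b0 b1 tA IH0 IH1 _ _.
  have a01 : a0 * a1 = 0 by nia.
  by split; [case/eqP: a01; rewrite muln_eq0 => /orP[]/eqP->; auto | nia].
split=> // y Ay V0y; have V1py := p0 _ V0y.
have [Apy|nApy] := boolP (p y \in A).
  by exists (p y); [rewrite inE Apy | left].
have : p y \in bd V A :&: V1.
  rewrite inE V1py andbT; apply/bdP; split; rewrite ?inE ?V1py ?orbT //.
  by exists y; rewrite ?adjE.
have /eqP<- : bd V1 (A :&: V1) == bd V A :&: V1 by rewrite eqEcard sb1.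
by case/bdP=> _ _ [x Ax xpy]; exists x; auto.
Qed.

End HypercubeLike.

(** * Cayley graphs split by a two-valued map *)

Section CayleySplit.
Local Open Scope group_scope.
Variables (gT : finGroupType) (S : {set gT}).

Lemma cayleyP x y :
  reflect (exists2 s, s \in S & y = s * x) (cayley S x y).
Proof.
by apply: (iffP exists_inP) => -[s Ss /eqP]; exists s => //; apply/eqP.
Qed.

(** If s is the only element of the connection set that changes chi, then the
edges between the two classes of chi are exactly those of the matching
x |-> s * x. *)
Lemma joined_cayley (s : gT) (chi : gT -> bool) (V : {set gT}) (e : bool) :
    s \in S -> s * s = 1 ->
    (forall t x, t \in S -> chi (t * x) = (t == s) (+) chi x) ->
    (forall x, x \in V -> s * x \in V) ->
  joined (cayley S) [set x in V | chi x == e] [set x in V | chi x == ~~ e]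
    (mulg s).
Proof.
move=> Ss ss chiM sV; split.
- rewrite disjoints_subset; apply/subsetP=> x; rewrite !inE => /andP[-> /eqP->].
  by case: e.
- move=> x; rewrite !inE => /andP[Vx /eqP]; rewrite sV // chiM // eqxx => ->.
  by case: e.
- move=> x; rewrite !inE => /andP[Vx /eqP]; rewrite sV // chiM // eqxx => ->.
  by case: e.
- by move=> x _; rewrite mulgA ss mul1g.
move=> x y; rewrite !inE => /andP[_ /eqP chix] /andP[_ /eqP chiy].
apply/cayleyP/eqP=> [[t St def_y]|->]; last by exists s.
by move: chiy; rewrite def_y chiM // chix; case: eqP => [->|_] //; case: (e).
Qed.

End CayleySplit.

(** * The factor: the Cayley graph of the dihedral group of order 8 *)

Section D8.
Local Open Scope group_scope.

Definition refl (s : bool) : 'D_8 := if s then D8_b else D8_a * D8_b.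

Definition Omega1 : {set 'D_8} := [set D8_a ^+ 2; D8_b; D8_a * D8_b].

(** Normal forms, in which products and equality are computed modulo 4 and 2. *)
Definition ab (i j : nat) : 'D_8 := D8_a ^+ i * D8_b ^+ j.

Lemma ab_mod i j : ab (i %% 4) (j %% 2) = ab i j.
Proof.
have [_ a4 b2 _] := D8_abP.
by rewrite /ab -(expg_mod i a4) -(expg_mod j b2).
Qed.

Lemma mulb_ab i j : D8_b * ab i j = ab (3 * i) j.+1.
Proof.
have [_ a4 b2 aVb] := D8_abP.
have aJb : D8_a ^ D8_b = D8_a ^+ 3.
  by rewrite conjgE mulgA aVb; apply/eqP; rewrite eq_invg_mul -expgS a4.
have bV : D8_b^-1 = D8_b by apply/eqP; rewrite eq_invg_mul -expg2 b2.
rewrite /ab expgM -aJb -conjXg conjgE bV expgS -!mulgA.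
by rewrite (mulgA D8_b D8_b) -expg2 b2 mul1g.
Qed.

Lemma ab_surj x : exists i, exists j, x = ab i j.
Proof.
have [gD _ _ aVb] := D8_abP.
have nab : <[D8_b]> \subset 'N(<[D8_a]>).
  by rewrite norms_cycle conjgE mulgA aVb groupV cycle_id.
have abG : <[D8_a]> * <[D8_b]> = [set: 'D_8].
  by rewrite -norm_joinEr // joing_idl joing_idr.
have : x \in <[D8_a]> * <[D8_b]> by rewrite abG inE.
by case/mulsgP=> _ _ /cycleP[i ->] /cycleP[j ->] ->; exists i, j.
Qed.

Lemma ab_eq i j i' j' :
  (ab i j == ab i' j') = (i == i' %[mod 4]) && (j == j' %[mod 2]).
Proof.
pose f (u : 'I_4 * 'I_2) := ab u.1 u.2.
have f_inj : injective f.
  have f_onto : codom f =i [set: 'D_8].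
    move=> x; rewrite inE; have [m [n ->]] := ab_surj x; rewrite -ab_mod.
    have m4 : m %% 4 < 4 by rewrite ltn_mod.
    have n2 : n %% 2 < 2 by rewrite ltn_mod.
    by apply/codomP; exists (Ordinal m4, Ordinal n2).
  apply/injectiveP/card_uniqP.
  by rewrite (eq_card f_onto) card_D8 size_codom card_prod !card_ord.
rewrite -(ab_mod i) -(ab_mod i').
have m4 m : m %% 4 < 4 by rewrite ltn_mod.
have n2 n : n %% 2 < 2 by rewrite ltn_mod.
exact: (inj_eq f_inj (Ordinal (m4 i), Ordinal (n2 j))
                     (Ordinal (m4 i'), Ordinal (n2 j'))).
Qed.

(** The homomorphism from D8 onto the group of order 2 that sends [refl s] to
the nontrivial element and kills [refl (~~ s)]. *)
Definition chi (s : bool) (x : 'D_8) : bool :=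
  [exists i : 'I_4, exists j : 'I_2, (x == ab i j) && odd (s * j + i)].

Lemma chi_ab s i j : chi s (ab i j) = odd (s * j + i).
Proof.
apply/existsP/idP => [[i' /existsP[j' /andP[]]]|odd_ij].
  by rewrite ab_eq; case: s => /=; lia.
have m4 : i %% 4 < 4 by rewrite ltn_mod.
have n2 : j %% 2 < 2 by rewrite ltn_mod.
exists (Ordinal m4); apply/existsP; exists (Ordinal n2).
by rewrite ab_mod eqxx /=; case: s odd_ij => /=; lia.
Qed.

Lemma a2E : D8_a ^+ 2 = ab 2 0. Proof. by rewrite /ab mulg1. Qed.

Lemma reflE s : refl s = ab (~~ s) 1.
Proof. by case: s; rewrite /ab ?mul1g. Qed.

Lemma mul_a2_ab i j : D8_a ^+ 2 * ab i j = ab i.+2 j.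
Proof. by rewrite /ab mulgA -expgD. Qed.

Lemma mul_refl_ab s i j : refl s * ab i j = ab (~~ s + 3 * i) j.+1.
Proof.
case: s; rewrite /= ?mulb_ab //= -mulgA mulb_ab.
by rewrite /ab mulgA -expgS.
Qed.

Lemma Omega1P x :
  reflect (x = D8_a ^+ 2 \/ exists s, x = refl s) (x \in Omega1).
Proof.
rewrite !inE; apply: (iffP idP) => [/orP[/orP[]|] /eqP->|[->|[[] ->]]];
  rewrite ?eqxx ?orbT //; first by left.
  by right; exists true.
by right; exists false.
Qed.

Lemma refl_Omega1 s : refl s \in Omega1.
Proof. by apply/Omega1P; right; exists s. Qed.

Lemma chi_mul s t x : t \in Omega1 -> chi s (t * x) = (t == refl s) (+) chi s x.
Proof.
have [i [j ->]] := ab_surj x; case/Omega1P=> [->|[u ->]].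
  by rewrite mul_a2_ab !chi_ab reflE a2E ab_eq; case: s => /=; lia.
by rewrite mul_refl_ab !chi_ab !reflE ab_eq; case: s; case: u => /=; lia.
Qed.

(** The two homomorphisms together have kernel {1, a^2}. *)
Lemma chi_eq x y : (forall s, chi s x = chi s y) -> y = x \/ y = D8_a ^+ 2 * x.
Proof.
have [i [j ->]] := ab_surj x; have [i' [j' ->]] := ab_surj y => eq_chi.
have := eq_chi true; have := eq_chi false.
rewrite !chi_ab mul_a2_ab /= => e0 e1.
by apply/pred2P; rewrite /= !ab_eq; lia.
Qed.

Lemma chi_onto e : exists x, forall s, chi s x = e s.
Proof.
exists (ab (e false) (e false + e true)) => s; rewrite chi_ab.
by case: s => /=; case: (e true); case: (e false).
Qed.

Lemma ab00 : ab 0 0 = 1. Proof. exact: mulg1. Qed.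

Lemma reflK s : refl s * refl s = 1.
Proof. by apply/eqP; rewrite {2}reflE mul_refl_ab -ab00 ab_eq; case: s. Qed.

Lemma a2_comm s : D8_a ^+ 2 * refl s = refl s * D8_a ^+ 2.
Proof.
by apply/eqP; rewrite {1}reflE mul_a2_ab {1}a2E mul_refl_ab ab_eq; case: s.
Qed.

Lemma a2K : D8_a ^+ 2 * D8_a ^+ 2 = 1.
Proof. by have [_ a4 _ _] := D8_abP; rewrite -expgD. Qed.

(** The product is three steps away from 1 along the 8-cycle, whereas the
neighbours of 1 are one or four steps away.  This is where the factor differs
from a 3-cube, in which the generators commute and the product is
[refl (~~ s)]. *)
Lemma refl_conj_notin s : refl s * refl (~~ s) * refl s \notin 1 |: Omega1.
Proof.
rewrite -mulgA [X in _ * (_ * X)]reflE !mul_refl_ab.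
apply/negP=> /setU1P[|/Omega1P[|[t]]] /eqP.
- by rewrite -ab00 ab_eq; case: s.
- by rewrite a2E ab_eq; case: s.
by rewrite reflE ab_eq; case: s; case: t.
Qed.

Lemma a_notin_Omega1 : D8_a \notin 1 |: Omega1.
Proof.
have -> : D8_a = ab 1 0 by rewrite /ab mulg1.
apply/negP=> /setU1P[|/Omega1P[|[t]]] /eqP.
- by rewrite -ab00 ab_eq.
- by rewrite a2E ab_eq.
by rewrite reflE ab_eq; case: t.
Qed.

(** A class of chi s is a 4-cycle: the classes of chi (~~ s) cut it into two
pairs {x, a^2 x}. *)
Lemma hl_D8_face s e : hl (cayley Omega1) 2 [set x | chi s x == e].
Proof.
pose V := [set x | chi s x == e].
pose F c := [set x in V | chi (~~ s) x == c].
have hF c : hl (cayley Omega1) 1 (F c).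
  have [x chix] := chi_onto (fun t => if t == s then e else c).
  have {chix} [xs xc] : chi s x = e /\ chi (~~ s) x = c.
    by rewrite !chix eqxx; case: (s).
  have -> : F c = [set x] :|: [set D8_a ^+ 2 * x].
    apply/setP=> y; rewrite !inE; apply/andP/pred2P => [[/eqP ys /eqP yc]|].
      apply: chi_eq => t; have [->|] := eqVneq t s; first by rewrite xs ys.
      move=> ts; suff -> : t = ~~ s by rewrite xc yc.
      by case: (t) (s) ts => -[].
    have a2t t : (D8_a ^+ 2 == refl t) = false.
      by rewrite a2E reflE ab_eq; case: t.
    have a2O : D8_a ^+ 2 \in Omega1 by apply/Omega1P; left.
    by case=> ->; rewrite ?chi_mul // ?a2t /= xs xc !eqxx; split.
  have x_ax : x != D8_a ^+ 2 * x.
    by rewrite -{1}(mul1g x) (inj_eq (mulIg x)) -ab00 a2E ab_eq.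
  suff j01 : joined (cayley Omega1) [set x] [set D8_a ^+ 2 * x]
      (mulg (D8_a ^+ 2)).
    exact: hl_join (hl_point _ _) (hl_point _ _) j01.
  split.
  - by rewrite disjoints1 inE.
  - by move=> y /set1P->; rewrite inE.
  - by move=> y /set1P->; rewrite mulgA a2K mul1g inE.
  - by move=> y _; rewrite mulgA a2K mul1g.
  move=> _ _ /set1P-> /set1P->; rewrite eqxx; apply/cayleyP.
  by exists (D8_a ^+ 2) => //; apply/Omega1P; left.
have -> : [set x | chi s x == e] = F true :|: F (~~ true).
  apply/setP=> x; rewrite !inE.
  by case: (chi (~~ s) x); rewrite ?andbT ?andbF ?orbF.
apply: (hl_join (hF _) (hF _)); apply: (joined_cayley (s := refl (~~ s)));
  rewrite ?refl_Omega1 ?reflK //.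
  by move=> t x Ot; apply: chi_mul.
move=> x; rewrite !inE chi_mul ?refl_Omega1 //.
by rewrite !reflE ab_eq; case: (s).
Qed.

Lemma hl_D8 : hl (cayley Omega1) 3 [set: 'D_8].
Proof.
pose F c := [set x in [set: 'D_8] | chi true x == c].
have hF c : hl (cayley Omega1) 2 (F c).
  suff -> : F c = [set x | chi true x == c] by apply: hl_D8_face.
  by apply/setP=> x; rewrite !inE.
have -> : [set: 'D_8] = F true :|: F (~~ true).
  by apply/setP=> x; rewrite !inE; case: (chi true x).
apply: (hl_join (hF _) (hF _)); apply: (joined_cayley (s := refl true));
  rewrite ?refl_Omega1 ?reflK //.
  by move=> t x Ot; apply: chi_mul.
by move=> x; rewrite !inE.
Qed.

End D8.

(** * Cartesian powers *)

Lemma hl_inv (T : finType) (adj : rel T) n (V : {set T}) : hl adj n V ->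
  if n is m.+1 then
    exists V0 V1 p, [/\ hl adj m V0, hl adj m V1, joined adj V0 V1 p
                      & V = V0 :|: V1]
  else exists x, V = [set x].
Proof.
by case=> {n V} [x|n V0 V1 p h0 h1 j01]; [exists x | exists V0, V1, p].
Qed.

Section Product.
Local Open Scope group_scope.
Variable k : nat.
Implicit Types (i j : 'I_k) (x y z v : Gk k).

Lemma inj_factorE i (s : 'D_8) j :
  inj_factor i s j = if j == i then s else 1.
Proof.
case: eqVneq => [->|ji]; first exact: dfung1_id.
by rewrite /inj_factor dfung1_dflt // eq_sym.
Qed.

Lemma inj_factor_mulE i (s : 'D_8) x j :
  (inj_factor i s * x) j = if j == i then s * x j else x j.
Proof. by rewrite mulg_ffun inj_factorE; case: eqP => // _; rewrite mul1g. Qed.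

Lemma GammaP x y :
  reflect (exists2 i, cayley Omega1 (x i) (y i) & forall j, j != i -> y j = x j)
          (Gamma k x y).
Proof.
apply: (iffP (cayleyP _ _ _)) => [[_ /OmegaP[i [s Os ->]] ->]|].
  exists i => [|j ji]; rewrite inj_factor_mulE ?(negPf ji) // eqxx.
  by apply/cayleyP; exists s.
case=> i /cayleyP[s Os yi] yj; exists (inj_factor i s).
  by apply/OmegaP; exists i, s.
apply/ffunP=> j; rewrite inj_factor_mulE; case: eqVneq => [->//|ji].
exact: yj.
Qed.

Definition box (C : 'I_k -> {set 'D_8}) : {set Gk k} :=
  [set x : Gk k | [forall i, x i \in C i]].

Lemma boxP (C : 'I_k -> {set 'D_8}) x :
  reflect (forall i, x i \in C i) (x \in box C).
Proof. by rewrite inE; apply: forallP. Qed.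

Definition upd {U : Type} i (u : U) (f : 'I_k -> U) j :=
  if j == i then u else f j.

(** A Cartesian product of hypercube-like networks is hypercube-like: as long as
some C i has more than one vertex, splitting C i splits the product. *)
Lemma hl_box (C : 'I_k -> {set 'D_8}) (r : 'I_k -> nat) :
    (forall i, hl (cayley Omega1) (r i) (C i)) ->
  hl (Gamma k) (\sum_(i < k) r i) (box C).
Proof.
have [n] := ubnP (\sum_(i < k) r i); elim: n => // n IHn in C r *.
rewrite ltnS => le_r_n hC; case: (pickP (fun i => 0 < r i)) => [i|r0].
  have /hl_inv := hC i; case def_r: (r i) => [|m] //.
  move=> [V0 [V1 [p [h0 h1 j01 def_C]]]] _.
  have sum_r : \sum_(j < k) r j = (\sum_(j < k) upd i m r j).+1.
    rewrite (bigD1 i) //= [in RHS](bigD1 i) //= def_r addSn /upd eqxx.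
    congr (_ + _).+1.
    by apply: eq_bigr => j /negPf->.
  have hU (V : {set 'D_8}) : hl (cayley Omega1) m V ->
      hl (Gamma k) (\sum_(j < k) upd i m r j) (box (upd i V C)).
    move=> hV; apply: IHn => [|j]; first by rewrite -sum_r.
    by rewrite /upd; case: eqP.
  have -> : box C = box (upd i V0 C) :|: box (upd i V1 C).
    apply/setP=> x; rewrite in_setU; apply/boxP/orP => [xC|[]/boxP xC j].
    - have := xC i; rewrite def_C => /setUP[] xi; [left|right];
        by apply/boxP=> j; rewrite /upd; case: eqP => [->|_].
    - have := xC j; rewrite /upd; case: eqP => // ->.
      by rewrite def_C inE => ->.
    have := xC j; rewrite /upd; case: eqP => // ->.
    by rewrite def_C inE orbC => ->.
  rewrite sum_r; pose q (x : Gk k) : Gk k := [ffun j => upd i (p (x i)) x j].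
  apply: (@hl_join _ _ _ _ _ q) (hU _ h0) (hU _ h1) _.
  have [d01 p0 p1 pK adjE] := j01; split.
  - rewrite disjoints_subset; apply/subsetP=> x /boxP/(_ i).
    rewrite {1}/upd eqxx in_setC => xi0; apply/negP=> /boxP/(_ i).
    by rewrite /upd eqxx (disjointFr d01 xi0).
  - move=> x /boxP xC; apply/boxP=> j; rewrite ffunE; have := xC j.
    by rewrite /upd; case: eqP => // ->; apply: p0.
  - move=> x /boxP xC; apply/boxP=> j; rewrite ffunE; have := xC j.
    by rewrite /upd; case: eqP => // ->; apply: p1.
  - move=> x xC; have xi : x i \in V0 :|: V1.
      case/setUP: xC => /boxP/(_ i); rewrite /upd eqxx => xi;
        by rewrite inE xi ?orbT.
    apply/ffunP=> j; rewrite ffunE /upd; case: eqVneq => [->|/negPf ji].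
      by rewrite ffunE /upd eqxx pK.
    by rewrite ffunE /upd ji.
  move=> x y /boxP xC /boxP yC.
  have xi := xC i; have yi := yC i; rewrite /upd !eqxx in xi yi.
  apply/GammaP/eqP => [[j xyj eq_xy]|->].
    have ij : i = j.
      apply/eqP; apply: contraTT yi => /eq_xy->.
      by rewrite (disjointFr d01 xi).
    apply/ffunP=> l; rewrite ffunE /upd; case: eqP => [->|/eqP li].
      by apply/eqP; rewrite -adjE // ij.
    by apply: eq_xy; rewrite -ij.
  exists i; first by rewrite ffunE /upd eqxx adjE // p0 // .
  by move=> j /negPf ji; rewrite ffunE /upd ji.
have r0' i : r i = 0 by have := r0 i; case: (r i).
rewrite big1 => [|i _]; last exact: r0'.
have C1 i : exists g, C i == [set g].
  by have /hl_inv := hC i; rewrite r0' => -[g ->]; exists g.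
pose c : Gk k := [ffun i => xchoose (C1 i)].
suff -> : box C = [set c] by apply: hl_point.
apply/setP=> x; rewrite inE; apply/boxP/eqP => [xC|-> i].
  apply/ffunP=> i; rewrite ffunE; apply/set1P.
  by rewrite -(eqP (xchooseP (C1 i))).
by rewrite ffunE {2}(eqP (xchooseP (C1 i))) set11.
Qed.

Definition side i s x := chi s (x i).

Definition flip i s : Gk k := inj_factor i (refl s).

Lemma hl_setT : hl (Gamma k) (3 * k) [set: Gk k].
Proof.
have -> : [set: Gk k] = box (fun=> [set: 'D_8]).
  by apply/setP=> x; rewrite inE; apply/esym/boxP=> i; rewrite inE.
have -> : (3 * k = \sum_(i < k) 3)%N by rewrite sum_nat_const card_ord mulnC.
by apply: hl_box => i; apply: hl_D8.
Qed.

Lemma hl_side i s e : hl (Gamma k) (3 * k).-1 [set x | side i s x == e].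
Proof.
pose C := upd i [set g | chi s g == e] (fun=> [set: 'D_8]).
have -> : [set x | side i s x == e] = box C.
  apply/setP=> x; rewrite inE; apply/idP/boxP => [xi j|/(_ i)].
    by rewrite /C /upd; case: eqP => [->|_]; rewrite !inE.
  by rewrite /C /upd eqxx inE.
have -> : ((3 * k).-1 = \sum_(j < k) upd i 2 (fun=> 3) j)%N.
  have -> : (3 * k = \sum_(i < k) 3)%N by rewrite sum_nat_const card_ord mulnC.
  rewrite (bigD1 i) //= [in RHS](bigD1 i) //= /upd eqxx addSn /=; congr _.+2.
  by apply: eq_bigr => j /negPf->.
apply: hl_box => j; rewrite /C /upd; case: eqP => _; last exact: hl_D8.
exact: hl_D8_face.
Qed.

Lemma hl_slice i (g : 'D_8) : hl (Gamma k) (3 * k.-1) [set x : Gk k | x i == g].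
Proof.
pose C := upd i [set g] (fun=> [set: 'D_8]).
have -> : [set x : Gk k | x i == g] = box C.
  apply/setP=> x; rewrite inE; apply/idP/boxP => [xi j|/(_ i)].
    by rewrite /C /upd; case: eqP => [->|_]; rewrite !inE.
  by rewrite /C /upd eqxx inE.
have -> : (3 * k.-1 = \sum_(j < k) upd i 0 (fun=> 3) j)%N.
  rewrite (bigD1 i) //= /upd eqxx.
  rewrite (eq_bigr (fun=> 3)) => [|j /negPf-> //].
  by rewrite sum_nat_const cardC1 card_ord mulnC.
apply: hl_box => j; rewrite /C /upd; case: eqP => _; last exact: hl_D8.
exact: hl_point.
Qed.

End Product.

(** * Tight sets in the power *)

Section Tight.
Local Open Scope group_scope.
Variable k : nat.
Implicit Types (i j : 'I_k) (x y z v : Gk k) (s e : bool) (A : {set Gk k}).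

Lemma flip_Omega i s : flip i s \in Omega k.
Proof. by apply/OmegaP; exists i, (refl s) => //; apply: refl_Omega1. Qed.

Lemma flipK i s : flip i s * flip i s = 1.
Proof. by rewrite /flip -inj_factorM reflK inj_factor1. Qed.

Lemma inj_factor_eq i j (g h : 'D_8) : g != 1 ->
  inj_factor i g = inj_factor j h -> i = j /\ g = h.
Proof.
move=> g1 e; have /(congr1 (fun x : Gk k => x i)) := e.
rewrite !inj_factorE eqxx; case: eqVneq => [-> //|_ g1'].
by rewrite g1' eqxx in g1.
Qed.

Lemma Omega1_neq1 (g : 'D_8) : g \in Omega1 -> g != 1.
Proof.
apply: contraTneq => ->; apply/negP=> /Omega1P[|[s]] /eqP.
  by rewrite -ab00 a2E ab_eq.
by rewrite -ab00 reflE ab_eq; case: s.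
Qed.

Lemma refl_inj : injective refl.
Proof. by move=> s t /eqP; rewrite !reflE ab_eq; case: s; case: t. Qed.

Lemma flip_eq i s j t : flip i s = flip j t -> i = j /\ s = t.
Proof.
by case/(inj_factor_eq (Omega1_neq1 (refl_Omega1 s))) => -> /refl_inj ->.
Qed.

Lemma side_mul i s t x :
  t \in Omega k -> side i s (t * x) = (t == flip i s) (+) side i s x.
Proof.
case/OmegaP=> j [g Og ->]; rewrite /side inj_factor_mulE /flip.
case: eqVneq => [->|ij].
  by rewrite chi_mul // (inj_eq (@inj_factor_inj _ _)).
case: eqP => // /(inj_factor_eq (Omega1_neq1 Og))[ji].
by rewrite ji eqxx in ij.
Qed.

Lemma side_flip i s x : side i s (flip i s * x) = ~~ side i s x.
Proof. by rewrite side_mul ?flip_Omega // eqxx. Qed.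

Lemma Omega_coord u j : u \in 1 |: Omega k -> u j \in 1 |: Omega1.
Proof.
case/setU1P=> [->|/OmegaP[i [g Og ->]]]; first by rewrite ffunE setU11.
by rewrite inj_factorE; case: eqP => _; rewrite !in_setU1 ?Og ?eqxx ?orbT.
Qed.

Lemma flip_comm i s t : t \in Omega k -> (forall e, t != flip i e) ->
  t * flip i s = flip i s * t.
Proof.
case/OmegaP=> j [g Og ->] nt; apply/ffunP=> l.
rewrite !mulg_ffun /flip !inj_factorE.
case: eqVneq => [lj|_]; case: eqVneq => [li|_]; rewrite ?mulg1 ?mul1g //.
rewrite {l}lj in li; case/Omega1P: Og => [->|[e def_g]]; first exact: a2_comm.
by have := nt e; rewrite def_g li eqxx.
Qed.

Lemma tight_sides i s e A : tight (Gamma k) (3 * k) [set: Gk k] A ->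
    (exists2 y, y \in A & side i s y = e) ->
    (exists2 y, y \in A & side i s y = ~~ e) ->
  (exists c x, A :&: [set y | side i s y == c] = [set x]) /\
  (forall y, y \in A -> side i s y = e ->
     exists2 x, x \in A /\ side i s x = ~~ e
       & exists2 u, u \in 1 |: Omega k & flip i s * y = u * x).
Proof.
move=> tA [y0 Ay0 y0e] [y1 Ay1 y1e].
have TI c : [set x in [set: Gk k] | side i s x == c] =
            [set x | side i s x == c].
  by apply/setP=> y; rewrite !inE.
have splitT : [set: Gk k] =
    [set x | side i s x == e] :|: [set x | side i s x == ~~ e].
  by apply/setP=> y; rewrite !inE; case: (side i s y) (e) => -[].
have k_gt0 : (0 < 3 * k)%N.
  by rewrite muln_gt0 /=; apply: leq_ltn_trans (ltn_ord i).
rewrite splitT -(prednK k_gt0) in tA.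
have jT : joined (Gamma k) [set x | side i s x == e]
    [set x | side i s x == ~~ e] (mulg (flip i s)).
  rewrite -!TI; apply: joined_cayley; rewrite ?flip_Omega ?flipK //.
    exact: side_mul.
  by move=> y; rewrite !inE.
have [] := tight_split (@Gamma_sym k) (hl_side _ _ _) (hl_side _ _ _) jT _ tA.
- by rewrite -splitT subsetT.
- by apply/set0Pn; exists y0; rewrite !inE Ay0 y0e eqxx.
- by apply/set0Pn; exists y1; rewrite !inE Ay1 y1e eqxx.
move=> one near; split.
  by case: one => /eqP/cards1P[x def_x]; [exists e, x | exists (~~ e), x].
move=> y Ay ye; have [|x] := near y Ay; first by rewrite inE ye.
rewrite !inE => /andP[Ax /eqP xe] [->|/cayleyP[u Ou ->]]; exists x => //.
  by exists 1; rewrite ?setU11 ?mul1g.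
by exists u; rewrite // in_setU1 Ou orbT.
Qed.

(** The situation of [tight_split], with flip i s as the matching and x as the
lone vertex of A in one half. *)
Definition exceptional i s A x : Prop := forall y, y \in A -> y != x ->
  side i s y = ~~ side i s x /\
  exists2 u, u \in 1 |: Omega k & flip i s * y = u * x.

Lemma tight_exceptional i s A y z : tight (Gamma k) (3 * k) [set: Gk k] A ->
    y \in A -> z \in A -> side i s y != side i s z ->
  exists2 x, x \in A & exceptional i s A x.
Proof.
move=> tA Ay Az yz.
have both c : exists2 y, y \in A & side i s y = c.
  have [yc|yc] := eqVneq (side i s y) c; first by exists y.
  by exists z => //; case: (side i s y) (side i s z) c yz yc => -[] [].
have [[c [x def_x]] _] := tight_sides tA (both true) (both false).
have /setIP[Ax] : x \in A :&: [set y | side i s y == c] by rewrite def_x set11.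
rewrite inE => /eqP xc; exists x => // w Aw wx.
have wc : side i s w = ~~ c.
  have : w \notin A :&: [set y | side i s y == c] by rewrite def_x inE.
  by rewrite !inE Aw; case: (side i s w) (c) => -[].
split; first by rewrite xc.
have [_ near] := tight_sides tA (both (~~ c)) (both (~~ ~~ c)).
have [x' [Ax' x'c]] := near w Aw wc; suff -> : x' = x by [].
by apply/set1P; rewrite -def_x !inE Ax' x'c negbK eqxx.
Qed.

(** If two further vertices of A are on the side opposite to x, then x has to be
the exceptional vertex. *)
Lemma tight_minority i s A x y1 y2 : tight (Gamma k) (3 * k) [set: Gk k] A ->
    x \in A -> y1 \in A -> y2 \in A -> y1 != y2 ->
    side i s y1 != side i s x -> side i s y2 != side i s x ->
  exceptional i s A x.
Proof.
move=> tA Ax Ay1 Ay2 y12 y1x y2x.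
have [x' Ax' ex'] := tight_exceptional tA Ay1 Ax y1x.
have [-> // | xx'] := eqVneq x x'; have [sx _] := ex' x Ax xx'.
wlog y1x' : y1 y2 Ay1 Ay2 y12 y1x y2x / y1 != x'.
  move=> IH; have [y1E|] := eqVneq y1 x'; last exact: (IH y1 y2).
  by apply: (IH y2 y1) => //; rewrite eq_sym // -y1E.
by have [sy1 _] := ex' y1 Ay1 y1x'; rewrite sx sy1 eqxx in y1x.
Qed.

(** If no side map separates A, then the 2k sets flip i s * A are disjoint from
A and, being separated by the side maps, from each other. *)
Lemma tight_const A : tight (Gamma k) (3 * k) [set: Gk k] A ->
    (forall i s, {in A &, forall y z, side i s y = side i s z}) ->
  (#|A| * #|A|.+1 <= 2 * k * #|A| + 2)%N.
Proof.
move=> tA cA; pose f (u : 'I_k * bool * Gk k) := flip u.1.1 u.1.2 * u.2.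
pose D := setX [set: 'I_k * bool] A.
have f_inj : {in D &, injective f}.
  move=> [[i s] x] [[j t] y]; rewrite !inE /f /= => Ax Ay fxy.
  have := congr1 (side i s) fxy; rewrite side_flip side_mul ?flip_Omega //.
  rewrite (cA i s x y Ax Ay); case: eqP => [/flip_eq[ji ts] _|_].
    by rewrite ji ts in fxy *; rewrite (mulgI _ _ _ fxy).
  by case: (side i s y).
have f_bd : f @: D \subset bd (Gamma k) [set: Gk k] A.
  apply/subsetP=> _ /imsetP[[[i s] x] + ->]; rewrite !inE /f /= => Ax.
  rewrite andbT; apply/andP; split.
    apply: contraNN (negbT (erefl false)) => Afx.
    by have := cA i s _ _ Ax Afx; rewrite side_flip; case: (side i s x).
  by apply/exists_inP; exists x => //; apply/cayleyP; exists (flip i s);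
    rewrite ?flip_Omega.
have := subset_leq_card f_bd; rewrite (card_in_imset f_inj) cardsX cardsT.
rewrite card_prod card_ord card_bool; move: tA; rewrite /tight; nia.
Qed.

(** Here A is contained in the closed neighbourhood of v.  If both flips of v
in the direction i are in A, the first is exceptional for its own side map, as
the other vertices of A are on the side of v.  So the flip of the second one is
close to the first one, which [refl_conj_notin] excludes. *)
Lemma tight_no_corner A v i : tight (Gamma k) (3 * k) [set: Gk k] A ->
    (forall y, y \in A -> y = v \/ exists2 t, t \in Omega k & y = t * v) ->
    3 < #|A| ->
  ~ (forall s, flip i s * v \in A).
Proof.
move=> tA starA A_gt3 cornerA.
pose z := flip i true * v; pose y := flip i false * v.
have yz : y != z.
  by rewrite (inj_eq (mulIg v)); apply/eqP=> /flip_eq[].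
have [w Aw /norP[wz wy]] : exists2 w, w \in A & ~~ ((w == z) || (w == y)).
  have : ~~ (A \subset [set z; y]).
    apply: contraL A_gt3 => /subset_leq_card; rewrite cards2.
    by case: eqP => _; lia.
  by case/subsetPn=> w Aw; rewrite !inE; exists w.
have sz : side i true z = ~~ side i true v by apply: side_flip.
have sy : side i true y = side i true v.
  by rewrite side_mul ?flip_Omega //; case: eqP => // /flip_eq[].
have sw : side i true w = side i true v.
  case: (starA w Aw) => [->//|[t Ot def_w]]; rewrite def_w side_mul //.
  by case: eqP => // tE; rewrite def_w tE eqxx in wz.
have ex : exceptional i true A z.
  apply: (tight_minority tA _ (cornerA false) Aw); rewrite ?cornerA 1?eq_sym //.
    by rewrite sz sy; case: side.
  by rewrite sz sw; case: side.
have [_ [u Ou]] := ex _ (cornerA false) yz; rewrite !mulgA => /mulIg def_u.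
have := refl_conj_notin true.
rewrite /= -[D8_a * D8_b]/(refl false) -[D8_b]/(refl true).
suff -> : refl true * refl false * refl true = u i by rewrite Omega_coord.
have /(congr1 (fun x : Gk k => x i)) := def_u.
rewrite !mulg_ffun !inj_factorE eqxx => ->.
by rewrite -mulgA reflK mulg1.
Qed.

(** With x exceptional for (i, s), the partner v of x is a centre of A: every
other vertex y of A is flip i s * u * x with u in the connection set or u = 1.
This is v for u = 1, it is u * v if u commutes with flip i s, and only for
u = flip i (~~ s) is it a vertex e at distance 2 from v. *)
Lemma tight_lt A : 1 < k -> tight (Gamma k) (3 * k) [set: Gk k] A ->
  #|A| < 2 * k + 2.
Proof.
move=> k_gt1 tA; rewrite ltnNge; apply/negP=> geA.
have [[i s]|cA] := pickP (fun u : 'I_k * bool =>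
    ~~ [forall y in A, forall z in A,
          side u.1 u.2 y == side u.1 u.2 z]); last first.
  suff : (#|A| * #|A|.+1 <= 2 * k * #|A| + 2)%N by nia.
  apply: tight_const => // i s y z Ay Az.
  by have /negbFE/forall_inP/(_ y Ay)/forall_inP/(_ z Az)/eqP := cA (i, s).
case/forall_inPn=> y Ay /forall_inPn[z Az] /= yz.
have {y Ay z Az yz}[x Ax ex] := tight_exceptional tA Ay Az yz.
pose v := flip i s * x; pose e := flip i s * flip i (~~ s) * x.
have xE : x = flip i s * v by rewrite mulgA flipK mul1g.
have starA y : y \in A -> [\/ y = x, y = v, y = e |
    exists2 t, t \in Omega k /\ (forall c, t != flip i c) & y = t * v].
  move=> Ay; have [->|yx] := eqVneq y x; first by constructor 1.
  have [_ [u Ou def_y]] := ex y Ay yx.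
  have {def_y} yE : y = flip i s * (u * x) by rewrite -def_y mulgA flipK mul1g.
  case/setU1P: Ou => [u1|Ou]; first by constructor 2; rewrite yE u1 mul1g.
  have [us|us] := eqVneq u (flip i s).
    by rewrite yE us mulgA flipK mul1g eqxx in yx.
  have [us'|us'] := eqVneq u (flip i (~~ s)).
    by constructor 3; rewrite yE us' mulgA.
  have nu c : u != flip i c by case: (c) (s) us us' => -[].
  constructor 4; exists u => //.
  by rewrite yE mulgA -flip_comm // -mulgA.
have flip_neq c : (flip i c == flip i (~~ c)) = false.
  by apply/eqP=> /flip_eq[_]; case: c.
(* If e is in A, it is exceptional for (i, ~~ s).  Then A has no neighbours of
   v in other factors than i, since flipping such a vertex at i does not lead
   near e; at most four vertices are left. *)
have [Ae|nAe] := boolP (e \in A).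
  have : A \subset [set x; v; e; inj_factor i (D8_a ^+ 2) * v].
    apply/subsetP=> y Ay; rewrite !inE.
    case: (starA y Ay) => [->|->|->|[t [Ot nt] def_y]]; rewrite ?eqxx ?orbT //.
    suff tE : t = inj_factor i (D8_a ^+ 2) by rewrite def_y tE eqxx !orbT.
    case/OmegaP: Ot nt def_y (Ot) => j [g Og ->] nt def_y Ot.
    have [ji|ij] := eqVneq i j.
      rewrite -ji in nt *; case/Omega1P: Og nt => [-> //|[c ->] nt].
      by have := nt c; rewrite eqxx.
    have side_y c : side i c y = side i c v.
      by rewrite def_y side_mul // (negPf (nt c)).
    have side_v : side i (~~ s) v = side i (~~ s) x.
      by rewrite side_mul ?flip_Omega // flip_neq.
    have side_e : side i (~~ s) e = ~~ side i (~~ s) x.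
      by rewrite /e -mulgA side_mul ?flip_Omega // flip_neq side_flip.
    have xy : x != y.
      apply/eqP=> xy; have := side_y s; rewrite -xy side_flip.
      by case: side.
    have ex' : exceptional i (~~ s) A e.
      by apply: (tight_minority tA Ae Ax Ay xy);
        rewrite side_e ?side_y ?side_v; case: side.
    have ye : y != e.
      apply/eqP=> ye; have := side_y (~~ s); rewrite ye side_v side_e.
      by case: side.
    have [_ [u Ou]] := ex' y Ay ye; rewrite def_y !mulgA => /mulIg def_u.
    have ui : u i = 1.
      have /(congr1 (fun x : Gk k => x j)) := def_u.
      rewrite !mulg_ffun !inj_factorE eqxx eq_sym (negPf ij) !mulg1 mul1g => uj.
      case/setU1P: Ou uj => [->|/OmegaP[l [h _ ->]]].
        by rewrite ffunE => g1; have := Omega1_neq1 Og; rewrite g1 eqxx.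
      rewrite !inj_factorE; case: eqVneq => [<- _|_ g1].
        by rewrite (negPf ij).
      by have := Omega1_neq1 Og; rewrite g1 eqxx.
    have /(congr1 (fun x : Gk k => x i)) := def_u.
    rewrite !mulg_ffun !inj_factorE eqxx (negPf ij) ui mulg1 mul1g => reflC.
    have := refl_conj_notin s; rewrite -mulgA reflC mulgA reflK mul1g.
    by rewrite in_setU1 refl_Omega1 orbT.
  move/subset_leq_card; apply/negP; rewrite -ltnNge.
  apply: (leq_trans _ geA); rewrite -!setUA !cardsU1 cards1.
  by do 3!case: (_ \notin _); lia.
have A_gt3 : 3 < #|A| by lia.
have starA' y : y \in A -> y = v \/ exists2 t, t \in Omega k & y = t * v.
  move=> Ay; case: (starA y Ay) => [->|->|ye|[t [Ot _] ->]].
  - by right; exists (flip i s) => //; apply: flip_Omega.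
  - by left.
  - by rewrite -ye Ay in nAe.
  by right; exists t.
have noA j := @tight_no_corner A v j tA starA' A_gt3.
pose N := [set t in Omega k | t * v \in A].
(* Each factor contributes at most two neighbours: the antipode and one flip. *)
have leN : #|N| <= 2 * k.
  pose c j := flip j true * v \in A.
  pose f (u : 'I_k * bool) : Gk k :=
    if u.2 then inj_factor u.1 (D8_a ^+ 2) else flip u.1 (c u.1).
  have : N \subset [set f u | u in [set: 'I_k * bool]].
    apply/subsetP=> t; rewrite inE => /andP[/OmegaP[j [g Og ->]] Atv].
    apply/imsetP; case/Omega1P: Og Atv => [->|[b ->]] Atv.
      by exists (j, true); rewrite ?inE.
    exists (j, false); rewrite ?inE //; congr (inj_factor _ (refl _)) => /=.
    rewrite /c; case: b Atv => [->|Aj0] //; symmetry; apply/negP=> Aj1.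
    by apply: (noA j) => -[].
  move/subset_leq_card/leq_trans; apply.
  apply: leq_trans (leq_imset_card _ _) _.
  by rewrite cardsT card_prod card_ord card_bool mulnC.
pose M := [set t * v | t in N].
have leM : #|M| <= 2 * k := leq_trans (leq_imset_card _ _) leN.
have : A \subset v |: M.
  apply/subsetP=> y Ay; rewrite in_setU1; apply/predU1P.
  case: (starA' y Ay) => [|[t Ot yE]]; [by left | right].
  by apply/imsetP; exists t; rewrite // inE Ot -yE.
move/subset_leq_card; rewrite cardsU1.
move: leM geA; move: #|A| #|M| => a m leM geA.
by case: (_ \notin _) => /=; lia.
Qed.

End Tight.

(** * Cutsets of the power *)

(** The cutset consists of the vertices whose coordinate i is a neighbour of 1.
The slices of constant coordinate i are connected, and a path from 1 that
avoids the cutset never changes this coordinate. *)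
Lemma Rg_cutset_ex (k g : nat) : 0 < k -> g + 4 <= 3 * k ->
  exists S, Rg_cutset (Gamma k) g S.
Proof.
move=> k_gt0 le_g; pose i := Ordinal k_gt0.
pose S := [set x : Gk k | x i \in Omega1].
have slice (x : Gk k) : x \notin S ->
    [set y : Gk k | y i == x i] \subset component (Gamma k) S x.
  move=> Sx; apply/subsetP=> y yi; rewrite inE.
  apply: (hl_connect (@Gamma_sym k) (hl_slice i (x i))) yi; last by rewrite inE.
  move=> u w; rewrite !inE => /eqP ui /eqP wi uw.
  by apply/and3P; split=> //; rewrite inE ?ui ?wi; rewrite inE in Sx.
exists S; apply/andP; split; last first.
  apply/forall_inP=> x; rewrite inE => Sx.
  apply: leq_trans (subset_leq_card (slice x Sx)).
  rewrite (hl_card (hl_slice i (x i))).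
  by apply: leq_trans (ltn_expl (3 * k.-1) (isT : 1 < 2)); lia.
pose y : Gk k := inj_factor i D8_a.
have yi : y i = D8_a by rewrite inj_factorE eqxx.
have := a_notin_Omega1; rewrite in_setU1 negb_or => /andP[a1 aO].
have S1 : (1%g : Gk k) \notin S.
  by rewrite inE ffunE; apply/negP=> /Omega1_neq1; rewrite eqxx.
have Sy : y \notin S by rewrite inE yi.
apply/negP=> /forall_inP/(_ 1%g); rewrite inE => /(_ S1).
move/forall_inP/(_ y); rewrite inE => /(_ Sy) /connectP[p].
suff last1 (x : Gk k) : x i = 1%g -> path (del_adj (Gamma k) S) x p ->
    last x p i = 1%g.
  move=> p1 yE; have := last1 1%g (ffunE _ _) p1.
  by rewrite -yE yi => /eqP; rewrite (negPf a1).
elim: p x => //= z p IHp x xi /andP[/and3P[_ Sz xz]]; apply: IHp.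
case/GammaP: xz => j /cayleyP[s Os zj] eq_xz.
have [ij|ij] := eqVneq i j; last by rewrite eq_xz.
by move: Sz; rewrite inE ij zj -ij xi mulg1 Os.
Qed.

(** The inequality f_(3k)(g) < #|S|, doubled to stay in the natural numbers. *)
Lemma card_Rg_cutset (k g : nat) (S : {set Gk k}) :
    2 * k + 1 <= g -> g + 4 <= 3 * k -> Rg_cutset (Gamma k) g S ->
  2 * (3 * k) * (g + 1) < 2 * #|S| + g * (g + 3).
Proof.
move=> ge_g le_g /andP[cutS /forall_inP bigS].
have {cutS} [x [y [Sx Sy nxy]]] : exists x, exists y, [/\ x \notin S, y \notin S
    & ~~ connect (del_adj (Gamma k) S) x y].
  case/forall_inPn: cutS => x; rewrite inE => Sx /forall_inPn[y].
  by rewrite inE => Sy nxy; exists x, y.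
have del_sym : connect_sym (del_adj (Gamma k) S).
  apply: sym_connect_sym => u w.
  by apply/and3P/and3P=> -[Su Sw uw]; split=> //; rewrite Gamma_sym.
pose A := component (Gamma k) S x; pose B := ~: (S :|: A).
have sub_component z u :
    z \notin S -> u \in component (Gamma k) S z -> u \notin S.
  move=> Sz; rewrite inE del_sym => /connectP[[|w p] /=]; first by move=> _ <-.
  by case/andP=> /and3P[].
have AS u : u \in A -> u \notin S by apply: sub_component.
have sepAB : separated (Gamma k) [set: Gk k] A B.
  split; rewrite ?subsetT //.
    by rewrite disjoints_subset setCK subsetUr.
  move=> u w Au; rewrite !inE negb_or => /andP[Sw nAw].
  apply: contra nAw => uw; have := Au; rewrite inE => /connect_trans; apply.
  by apply/connect1/and3P; rewrite Sw uw AS.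
have SE : [set: Gk k] :\: (A :|: B) = S.
  apply/setP=> u.
  rewrite in_setD in_setU in_setC in_setU in_setT andbT negb_or negbK.
  by case: (boolP (u \in A)) => [/AS/negPf->|_] //; rewrite orbF.
have geA : g < #|A| by apply: bigS; rewrite inE.
have geB : g < #|B|.
  apply: leq_trans (bigS y _) _; first by rewrite inE.
  apply: subset_leq_card; apply/subsetP=> u yu.
  rewrite in_setC in_setU negb_or; apply/andP; split; last first.
    apply: contra nxy; rewrite inE => /connect_trans; apply.
    by rewrite del_sym; rewrite inE in yu.
  exact: sub_component yu.
have hV := hl_setT k.
(* A side of size m with g + 1 <= m <= 3k - 2: for m > g + 1 the bound h(m)
   exceeds h(g + 1), and for m = g + 1 >= 2k + 2 the side is not tight. *)
have small (C D : {set Gk k}) : separated (Gamma k) [set: Gk k] C D ->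
    [set: Gk k] :\: (C :|: D) = S -> g < #|C| -> #|C| + 2 < 3 * k + 1 ->
    2 * (3 * k) * (g + 1) < 2 * #|S| + g * (g + 3).
  move=> sepCD SCD gtC ltC; have := subset_leq_card (bd_separated sepCD).
  rewrite SCD; have nC : C != set0 by rewrite -card_gt0; lia.
  have := hl_bd_ge (@Gamma_sym k) hV (subsetT C) nC.
  have [eqC|neC] := eqVneq #|C| g.+1.
    have ntC : ~ tight (Gamma k) (3 * k) [set: Gk k] C.
      by move/tight_lt; rewrite eqC => /(_ ltac:(lia)); lia.
    rewrite /tight eqC in ntC *; lia.
  have [u cC] : exists u, #|C| = g + 2 + u by exists (#|C| - g - 2); lia.
  rewrite cC in ltC *.
  have [w ew] : exists w, 3 * k = g + 4 + w by exists (3 * k - g - 4); lia.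
  rewrite ew in ltC *; nia.
have [ltA|geA'] := ltnP (#|A| + 2) (3 * k + 1).
  exact: small sepAB SE geA ltA.
have [ltB|geB'] := ltnP (#|B| + 2) (3 * k + 1).
  apply: small (separated_sym (@Gamma_sym k) sepAB) _ geB ltB.
  by rewrite setUC.
have k_gt : 2 < 3 * k by lia.
have := hl_separators_large (@Gamma_sym k) k_gt hV sepAB.
rewrite SE => /(_ ltac:(lia) ltac:(lia)).
have [w ew] : exists w, 3 * k = g + 4 + w by exists (3 * k - g - 4); lia.
rewrite ew; clear -w; nia.
Qed.

Theorem theorem5p4 (k g : nat) (hg1 : 2 * k + 1 <= g) (hg2 : g + 4 <= 3 * k) :
  (f_ (3 * k) g < (kappa (Gamma k) g)%:R)%R.
Proof.
have [S cutS] : exists S, Rg_cutset (Gamma k) g S.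
  by apply: Rg_cutset_ex => //; lia.
have [S0 [cutS0 <- _]] := kappa_min cutS.
have := card_Rg_cutset hg1 hg2 cutS0; rewrite /f_.
rewrite -(Num.Theory.ltr_nat rat) !(GRing.natrM, GRing.natrD).
lra.
Qed.
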